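(* Let $f:\{0,1\}^X\to\{0,1\}$ be a Boolean function on $n$ variables such that $f$ and $\overline{f}$ are represented by smooth, simple structured $d$-DNNFs $\mathcal{D}$ and $\overline{\mathcal{D}}$, respectively, both respecting the same normalized vtree $T$ on $X$. Then there is a vtree $T'$ on $X\cup H$, where $H$ is a set of at most $n-2$ new (auxiliary) variables disjoint from $X$, and an SDD respecting $T'$ that represents $f$ (as a function not depending on the variables in $H$) and has size $\mathcal{O}((|\mathcal{D}|+|\overline{\mathcal{D}}|)^2)$.
   Context: An NNF on a variable set $X$ is a Boolean circuit with fan-in 2 $\wedge$-gates and unbounded fan-in $\vee$-gates whose inputs are literals $x,\overline{x}$ ($x\in X$) or constants $\bot,\top$; its size $|\cdot|$ is its number of gates. $\mathrm{vars}(u)$ is the set of variables occurring in the subcircuit at $u$. A DNNF requires the two children of each $\wedge$-gate to have disjoint variable sets; a $d$-DNNF additionally requires the functions at the children of each $\vee$-gate to be pairwise not simultaneously satisfiable. A vtree for $X$ is a full rooted binary tree with leaves in bijection with $X$; $\mathrm{vars}(v)$ for a vtree node is the set of variables at leaves below $v$. An $\wedge$-gate with children $u_l,u_r$ respects a vtree node $v$ with children $v_l,v_r$ if $\mathrm{vars}(u_l)\subseteq\mathrm{vars}(v_l)$ and $\mathrm{vars}(u_r)\subseteq\mathrm{vars}(v_r)$; a structured $d$-DNNF w.r.t. $T$ is a $d$-DNNF in which every $\wedge$-gate respects some node of $T$. A circuit is smooth if all children of each $\vee$-gate have the same variable set. A structured $d$-DNNF is simple if no edge goes between two $\vee$-gates,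 no $\vee$-gate has a child labeled $\bot$ or $\top$, and the only nodes computing the constant function $\bot$ are nodes labeled $\bot$. A vtree is normalized if for every inner node $v$ with left child $v_\ell$ and right child $v_r$ we have $|\mathrm{vars}(v_\ell)|\le|\mathrm{vars}(v_r)|$. A set of Boolean functions on the same variables is a partition if they are pairwise disjoint (never simultaneously 1), none is the constant $\bot$, and their disjunction is $\top$. An SDD respecting a vtree $T$ is defined inductively: a single node labeled $\bot$ or $\top$ (any $T$); a single node labeled by a literal on a variable of $T$; or an $\vee$-gate whose inputs are $\wedge$-gates $g_1,\dots,g_\ell$, each $g_i$ having inputs $p_i,s_i$, where $v$ is an inner node of $T$ with left child $v_L$ and right child $v_R$, the subcircuits at $p_1,\dots,p_\ell$ are SDDs respecting the subtree of $T$ rooted at $v_L$, those at $s_1,\dots,s_\ell$ are SDDs respecting the subtree rooted at $v_R$, and the functions computed at $p_1,\dots,p_\ell$ form a partition. The size of an SDD is its number of nodes (gates). *)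

(* Defs.v *)
(* Circuits are DAGs given as a list of gates,
   each gate referring to its children by (smaller) indices. Variables are nat. *)
From mathcomp Require Import all_boot.
Set Implicit Arguments. Unset Strict Implicit. Unset Printing Implicit Defensive.

Inductive gate :=
  | GConst of bool
  | GLit of nat & bool        (* GLit x true = x, GLit x false = x̄ *)
  | GAnd of nat & nat
  | GOr of seq nat.

Definition dgate := GConst false.

Record nnf := NNF { gates : seq gate; outn : nat }.

Definition gate_at (G : seq gate) (k : nat) : gate := nth dgate G k.

Definition nsize (C : nnf) : nat := size (gates C).

Definition children (g : gate) : seq nat :=
  match g with GAnd i j => [:: i; j] | GOr cs => cs | _ => [::] end.

Definition wf_nnf (C : nnf) : Prop :=
  outn C < size (gates C) /\
  forall k, k < size (gates C) ->
    forall c, c \in children (gate_at (gates C) k) -> c < k.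

Definition nnf_on (X : seq nat) (C : nnf) : Prop :=
  forall k x p, gate_at (gates C) k = GLit x p -> x \in X.

Definition gate_val (a : nat -> bool) (acc : seq bool) (g : gate) : bool :=
  match g with
  | GConst b => b
  | GLit x p => if p then a x else ~~ a x
  | GAnd i j => nth false acc i && nth false acc j
  | GOr cs => has (fun c => nth false acc c) cs
  end.

Definition node_vals (a : nat -> bool) (G : seq gate) : seq bool :=
  foldl (fun acc g => rcons acc (gate_val a acc g)) [::] G.

Definition nval (G : seq gate) (a : nat -> bool) (k : nat) : bool :=
  nth false (node_vals a G) k.

Definition represents (C : nnf) (f : (nat -> bool) -> bool) : Prop :=
  forall a, nval (gates C) a (outn C) = f a.

Definition gate_vars (acc : seq (seq nat)) (g : gate) : seq nat :=
  match g with
  | GConst _ => [::]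
  | GLit x _ => [:: x]
  | GAnd i j => nth [::] acc i ++ nth [::] acc j
  | GOr cs => flatten (map (fun c => nth [::] acc c) cs)
  end.

Definition node_vars_all (G : seq gate) : seq (seq nat) :=
  foldl (fun acc g => rcons acc (gate_vars acc g)) [::] G.

Definition nvars (G : seq gate) (k : nat) : seq nat := nth [::] (node_vars_all G) k.

Definition decomposable (C : nnf) : Prop :=
  forall k i j, k < size (gates C) -> gate_at (gates C) k = GAnd i j ->
    forall x, x \in nvars (gates C) i -> x \notin nvars (gates C) j.

Definition deterministic (C : nnf) : Prop :=
  forall k cs, k < size (gates C) -> gate_at (gates C) k = GOr cs ->
    forall c1 c2, c1 \in cs -> c2 \in cs -> c1 != c2 ->
      forall a, ~~ (nval (gates C) a c1 && nval (gates C) a c2).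

Definition smooth (C : nnf) : Prop :=
  forall k cs, k < size (gates C) -> gate_at (gates C) k = GOr cs ->
    forall c1 c2, c1 \in cs -> c2 \in cs ->
      nvars (gates C) c1 =i nvars (gates C) c2.

Inductive vtree := VLeaf of nat | VNode of vtree & vtree.

Fixpoint vleaves (t : vtree) : seq nat :=
  match t with VLeaf x => [:: x] | VNode l r => vleaves l ++ vleaves r end.

Fixpoint is_subtree (s t : vtree) : Prop :=
  s = t \/ match t with VLeaf _ => False
           | VNode l r => is_subtree s l \/ is_subtree s r end.

Definition vtree_on (T : vtree) (X : seq nat) : Prop :=
  uniq (vleaves T) /\ vleaves T =i X.

Definition normalized (T : vtree) : Prop :=
  forall l r, is_subtree (VNode l r) T -> size (vleaves l) <= size (vleaves r).

Definition and_respects (G : seq gate) (i j : nat) (v : vtree) : Prop :=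
  match v with
  | VLeaf _ => False
  | VNode l r => {subset nvars G i <= vleaves l} /\ {subset nvars G j <= vleaves r}
  end.

Definition structured (C : nnf) (T : vtree) : Prop :=
  forall k i j, k < size (gates C) -> gate_at (gates C) k = GAnd i j ->
    exists v, is_subtree v T /\ and_respects (gates C) i j v.

Definition structured_ddnnf (C : nnf) (T : vtree) : Prop :=
  wf_nnf C /\ decomposable C /\ deterministic C /\ structured C T.

Definition is_or (g : gate) : bool := if g is GOr _ then true else false.
Definition is_const (g : gate) : bool := if g is GConst _ then true else false.

Definition simple (C : nnf) : Prop :=
  (forall k cs, k < size (gates C) -> gate_at (gates C) k = GOr cs ->
     forall c, c \in cs ->
       ~~ is_or (gate_at (gates C) c) /\ ~~ is_const (gate_at (gates C) c)) /\
  (forall k, k < size (gates C) ->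
     (forall a, nval (gates C) a k = false) -> gate_at (gates C) k = GConst false).

Inductive is_sdd (G : seq gate) : nat -> vtree -> Prop :=
  | sdd_const k b T : gate_at G k = GConst b -> is_sdd G k T
  | sdd_lit k x p T : gate_at G k = GLit x p -> x \in vleaves T -> is_sdd G k T
  | sdd_or k cs T vL vR :
      gate_at G k = GOr cs ->
      is_subtree (VNode vL vR) T ->
      (forall c, c \in cs -> exists p s,
          gate_at G c = GAnd p s /\ is_sdd G p vL /\ is_sdd G s vR) ->
      (forall c1 c2 p1 s1 p2 s2, c1 \in cs -> c2 \in cs -> c1 != c2 ->
          gate_at G c1 = GAnd p1 s1 -> gate_at G c2 = GAnd p2 s2 ->
          forall a, ~~ (nval G a p1 && nval G a p2)) ->
      (forall c p s, c \in cs -> gate_at G c = GAnd p s -> exists a, nval G a p) ->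
      (forall a, exists c p s, [/\ c \in cs, gate_at G c = GAnd p s & nval G a p]) ->
      is_sdd G k T.

(* Main.v *)
(** Every gate [u] of [D] or [Dbar] used at a vtree node [v] belongs to a partition, consisting of
    such gates, of the assignments of [vars(v)].  At the root it is [D, Dbar].  If [v] has children
    [l] and [r], decomposing the members of a partition into rectangles [p /\ s] gives a partition
    by rectangles; fixing an assignment of [r] that satisfies one rectangle, the left factors of the
    rectangles it satisfies partition the assignments of [l], and symmetrically for [r].

    A rectangle [p /\ s] is an SDD with primes [p] and its negation.  A disjoint disjunction of
    rectangles needs no disjoint left factors if the rectangles themselves are the primes: the node
    [v] is replaced by a node whose left child is (a copy of) [v] and whose right child is a fresh
    leaf, and the subs are constants.  The negation is obtained by exchanging the constants.  Nodes
    with two leaves need no fresh leaf, which leaves at most [n - 2] of them. *)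
Require Import Defs.
From Stdlib Require Import Classical.
From mathcomp Require Import all_boot.
From mathcomp Require Import zify.

Set Implicit Arguments.
Unset Strict Implicit.
Unset Printing Implicit Defensive.

(** * Evaluation of circuits, vtrees *)

Definition wf_gates (G : seq gate) : Prop :=
  forall k, k < size G -> forall c, c \in children (gate_at G k) -> c < k.

Section GateFold.
Variables (V : Type) (d : V) (F : seq V -> gate -> V).
Hypothesis F_local : forall acc acc' g,
  (forall c, c \in children g -> nth d acc c = nth d acc' c) -> F acc g = F acc' g.

(** [node_vals a] and [node_vars_all] are both instances of this fold, so stability under appending
    gates and unfolding at a gate are proved once for both. *)
Definition gate_fold (G : seq gate) : seq V :=
  foldl (fun acc g => rcons acc (F acc g)) [::] G.

Lemma gate_fold_rcons G g : gate_fold (rcons G g) = rcons (gate_fold G) (F (gate_fold G) g).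
Proof. by rewrite /gate_fold foldl_rcons. Qed.

Lemma size_gate_fold G : size (gate_fold G) = size G.
Proof. by elim/last_ind: G => // G g IH; rewrite gate_fold_rcons !size_rcons IH. Qed.

Lemma gate_fold_cat G E k : k < size G -> nth d (gate_fold (G ++ E)) k = nth d (gate_fold G) k.
Proof.
move=> kG; elim/last_ind: E => [|E g IH]; first by rewrite cats0.
by rewrite -rcons_cat gate_fold_rcons nth_rcons size_gate_fold size_cat ltn_addr.
Qed.

Lemma nth_gate_fold G k : wf_gates G -> k < size G ->
  nth d (gate_fold G) k = F (gate_fold G) (gate_at G k).
Proof.
elim/last_ind: G k => // G g IH k wfG; rewrite size_rcons ltnS leq_eqVlt => /predU1P[->|kG].
  have gE : gate_at (rcons G g) (size G) = g by rewrite /gate_at nth_rcons ltnn eqxx.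
  rewrite gE gate_fold_rcons nth_rcons size_gate_fold ltnn eqxx.
  apply: F_local => c cg.
  have cG : c < size G by apply: (wfG (size G)); rewrite ?size_rcons // gE.
  by rewrite nth_rcons size_gate_fold cG.
have gE j : j < size G -> gate_at (rcons G g) j = gate_at G j.
  by move=> jG; rewrite /gate_at nth_rcons jG.
have wfG' : wf_gates G.
  by move=> j jG c; rewrite -gE // => /wfG; apply; rewrite size_rcons ltnW.
rewrite -cats1 gate_fold_cat // IH // cats1 gE //.
apply: F_local => c cg; rewrite -cats1 gate_fold_cat //.
exact: ltn_trans (wfG' _ kG _ cg) kG.
Qed.

End GateFold.

Lemma gate_val_local a acc acc' g :
  (forall c, c \in children g -> nth false acc c = nth false acc' c) ->
  gate_val a acc g = gate_val a acc' g.
Proof.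
case: g => //= [i j|cs] H; last by apply: eq_in_has.
by rewrite !H ?inE ?eqxx ?orbT.
Qed.

Lemma gate_vars_local acc acc' g :
  (forall c, c \in children g -> nth [::] acc c = nth [::] acc' c) ->
  gate_vars acc g = gate_vars acc' g.
Proof.
case: g => //= [i j|cs] H; last by congr flatten; apply/eq_in_map.
by rewrite !H ?inE ?eqxx ?orbT.
Qed.

Lemma nval_cat G E a k : k < size G -> nval (G ++ E) a k = nval G a k.
Proof. exact: gate_fold_cat. Qed.

Lemma nvalE G a k : wf_gates G -> k < size G ->
  nval G a k = gate_val a (node_vals a G) (gate_at G k).
Proof. exact: nth_gate_fold (@gate_val_local a) _ _. Qed.

Lemma nvarsE G k : wf_gates G -> k < size G ->
  nvars G k = gate_vars (node_vars_all G) (gate_at G k).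
Proof. exact: nth_gate_fold gate_vars_local _ _. Qed.

Lemma sub_nvars_children G k c : wf_gates G -> k < size G ->
  c \in children (gate_at G k) -> {subset nvars G c <= nvars G k}.
Proof.
move=> wfG kG ck x xc; rewrite (nvarsE wfG kG).
case: (gate_at G k) ck => //= [i j|cs] ck.
  by move: ck xc; rewrite !inE mem_cat => /pred2P[] -> ->; rewrite ?orbT.
by apply/flattenP; exists (nvars G c) => //; apply: map_f.
Qed.

Lemma eq_in_nval G a b k : wf_gates G -> k < size G ->
  {in nvars G k, a =1 b} -> nval G a k = nval G b k.
Proof.
move=> wfG; elim/ltn_ind: k => k IH kG ab.
have IHc c : c \in children (gate_at G k) -> nval G a c = nval G b c.
  move=> ck; have ltck := wfG _ kG _ ck.
  apply: IH ltck (ltn_trans ltck kG) _ => x xc.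
  exact/ab/(sub_nvars_children wfG kG ck).
move: ab; rewrite !nvalE // nvarsE //.
case: (gate_at G k) IHc => //= [x p IHc ab|i j IHc _|cs IHc _].
- by rewrite ab // inE.
- by rewrite -!/(nval G _ _) !IHc // !inE eqxx ?orbT.
- by apply: eq_in_has => c /IHc.
Qed.

Lemma mem_nvars G k x : wf_gates G -> k < size G -> x \in nvars G k ->
  exists j p, gate_at G j = GLit x p.
Proof.
move=> wfG; elim/ltn_ind: k => k IH kG; rewrite nvarsE //.
have IHc c : c \in children (gate_at G k) -> x \in nvars G c ->
    exists j p, gate_at G j = GLit x p.
  move=> ck; have ltck := wfG _ kG _ ck.
  exact: IH ltck (ltn_trans ltck kG).
case E: (gate_at G k) IHc => [//|y p|i j|cs] /= IHc.
- by rewrite inE => /eqP ->; exists k, p.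
- by rewrite mem_cat => /orP[]; apply: IHc; rewrite !inE eqxx ?orbT.
- by case/flattenP=> _ /mapP[c ccs ->]; apply: IHc.
Qed.

(** * Subtrees of a vtree *)

Lemma is_subtree_trans t2 t1 t3 : is_subtree t1 t2 -> is_subtree t2 t3 -> is_subtree t1 t3.
Proof.
move=> t12; elim: t3 => [x|l IHl r IHr].
  by case=> // E; rewrite -E.
case=> [E|]; first by rewrite -E.
by case=> H; right; [left; apply: IHl|right; apply: IHr].
Qed.

Lemma is_subtree_refl t : is_subtree t t.
Proof. by case: t => [x|l r]; left. Qed.

Lemma is_subtree_l l r : is_subtree l (VNode l r).
Proof. by right; left; exact: is_subtree_refl. Qed.

Lemma is_subtree_r l r : is_subtree r (VNode l r).
Proof. by right; right; exact: is_subtree_refl. Qed.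

Lemma sub_vleaves s t : is_subtree s t -> {subset vleaves s <= vleaves t}.
Proof.
elim: t => [x|l IHl r IHr]; first by case=> // ->.
case=> [-> //|].
by case=> H x /=; rewrite mem_cat; move=> xs; [rewrite (IHl H)|rewrite (IHr H) ?orbT].
Qed.

Lemma uniq_subtree s t : is_subtree s t -> uniq (vleaves t) -> uniq (vleaves s).
Proof.
elim: t => [x|l IHl r IHr]; first by case=> // ->.
case=> [-> //|H] /=; move: H.
by rewrite cat_uniq => H /and3P[? _ ?]; case: H => H; [apply: IHl|apply: IHr].
Qed.

(** The leaf sets of vtree nodes form a laminar family: descend until [v] or [w] is the root or the
    two lie below different children, whose leaves are disjoint by uniqueness. *)
Lemma subtree_cases v w t : uniq (vleaves t) -> is_subtree v t -> is_subtree w t ->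
  [\/ is_subtree v w, is_subtree w v |
      forall x, x \in vleaves v -> x \in vleaves w -> False].
Proof.
elim: t => [x|l IHl r IHr] /=; first by move=> _ [->|//] [->|//]; constructor 1; left.
move=> U [->|vH]; first by move=> H; constructor 2.
case=> [->|wH]; first by constructor 1; right.
move: U; rewrite cat_uniq => /and3P[Ul /hasPn dis Ur].
case: vH wH => vH [] wH; [exact: IHl| | |exact: IHr]; constructor 3 => x xv xw.
- by have := dis x (sub_vleaves wH xw); rewrite (sub_vleaves vH xv).
- by have := dis x (sub_vleaves vH xv); rewrite (sub_vleaves wH xw).
Qed.

Lemma is_sdd_subtree G k t T : is_subtree t T -> is_sdd G k t -> is_sdd G k T.
Proof.
move=> sub H; case: H sub => {k t}.
- by move=> k b t E _; apply: sdd_const E.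
- by move=> k x p t E xt sub; apply: sdd_lit E (sub_vleaves sub xt).
- move=> k cs t vL vR E subt H1 H2 H3 H4 sub.
  exact: sdd_or E (is_subtree_trans subt sub) H1 H2 H3 H4.
Qed.

Lemma gate_at_cat G E k : k < size G -> gate_at (G ++ E) k = gate_at G k.
Proof. by move=> kG; rewrite /gate_at nth_cat kG. Qed.

(** Induction on the gate index: descendants have smaller indices, hence lie in [G], where appending
    changes neither gates nor values. *)
Lemma is_sdd_cat G E k T : wf_gates G -> k < size G -> is_sdd G k T -> is_sdd (G ++ E) k T.
Proof.
move=> wfG; elim/ltn_ind: k T => k IH T kG H.
case: H IH kG => {k T}.
- by move=> k b t g _ kG; apply: (@sdd_const _ _ b); rewrite gate_at_cat.
- by move=> k x p t g xt _ kG; apply: (@sdd_lit _ _ x p) => //; rewrite gate_at_cat.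
move=> k cs t vL vR g sub H1 H2 H3 H4 IH kG.
have ck c : c \in cs -> c < k by move=> ccs; apply: (wfG _ kG); rewrite g.
have cG c : c \in cs -> c < size G by move/ck => ?; exact: ltn_trans kG.
have gc c : c \in cs -> gate_at (G ++ E) c = gate_at G c by move/cG/gate_at_cat->.
have psG c p s : c \in cs -> gate_at G c = GAnd p s -> p < c /\ s < c.
  by move=> ccs gcE; split; apply: (wfG _ (cG _ ccs)); rewrite gcE !inE eqxx ?orbT.
have pG c p s : c \in cs -> gate_at G c = GAnd p s -> p < size G.
  by move=> ccs /(psG _ _ _ ccs)[/ltn_trans + _]; apply; apply: cG.
apply: (@sdd_or _ _ cs _ vL vR) => //; first by rewrite gate_at_cat.
- move=> c ccs; have [p [s [cE [pL sR]]]] := H1 c ccs.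
  have [pc sc] := psG _ _ _ ccs cE.
  exists p, s; rewrite gc //; split=> //.
  have IHc j U : j < c -> is_sdd G j U -> is_sdd (G ++ E) j U.
    by move=> jc; apply: IH; [exact: ltn_trans (ck _ ccs)|exact: ltn_trans (cG _ ccs)].
  by split; apply: IHc.
- move=> c1 c2 p1 s1 p2 s2 c1cs c2cs c12; rewrite !gc // => E1 E2 a.
  by rewrite !nval_cat ?(pG _ _ _ _ E1) ?(pG _ _ _ _ E2) //; apply: H2 E1 E2 a.
- move=> c p s ccs; rewrite gc // => E1; have [a pa] := H3 _ _ _ ccs E1.
  by exists a; rewrite nval_cat ?(pG _ _ _ _ E1).
- move=> a; have [c [p [s [ccs E1 pa]]]] := H4 a.
  by exists c, p, s; rewrite gc // nval_cat ?(pG _ _ _ _ E1).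
Qed.

(** * Building SDDs by appending gates *)

Definition sat (g : (nat -> bool) -> bool) : Prop := exists a, g a.

(** Circuits grow only by appending, so a function once available stays available and can be shared;
    the final size is the sum of the lengths of the extensions. *)
Definition has_sdd G T (g : (nat -> bool) -> bool) : Prop :=
  exists k, [/\ k < size G, is_sdd G k T & forall a, nval G a k = g a].

Lemma has_sdd_cat G E T g : wf_gates G -> has_sdd G T g -> has_sdd (G ++ E) T g.
Proof.
move=> wfG [k [kG kT kg]]; exists k; split; first by rewrite size_cat ltn_addr.
  exact: is_sdd_cat.
by move=> a; rewrite nval_cat.
Qed.

Lemma has_sdd_subtree G t T g : is_subtree t T -> has_sdd G t g -> has_sdd G T g.
Proof. by move=> sub [k [kG kT kg]]; exists k; split=> //; apply: is_sdd_subtree kT. Qed.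

Lemma eq_has_sdd G T g g' : g =1 g' -> has_sdd G T g -> has_sdd G T g'.
Proof. by move=> gg [k [kG kT kg]]; exists k; split=> // a; rewrite -gg. Qed.

Lemma nth_count_ge2 (A : Type) (x0 : A) (P : pred A) s i j : i < j -> j < size s ->
  P (nth x0 s i) -> P (nth x0 s j) -> 1 < count P s.
Proof.
move=> ij js Pi Pj; rewrite -(cat_take_drop j s) count_cat (drop_nth x0) //= Pj.
suff: 0 < count P (take j s) by lia.
rewrite -has_count; apply/(has_nthP x0); exists i; last by rewrite nth_take.
by rewrite size_take js.
Qed.

Lemma wf_gates_rcons G g : wf_gates G -> (forall c, c \in children g -> c < size G) ->
  wf_gates (rcons G g).
Proof.
move=> wfG cg k; rewrite size_rcons ltnS leq_eqVlt => /predU1P[->|kG] c.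
  by rewrite /gate_at nth_rcons ltnn eqxx => /cg.
by rewrite -cats1 gate_at_cat // => /(wfG _ kG).
Qed.

Lemma gate_at_map G (A : Type) (x0 : A) (h : A -> gate) s E i : i < size s ->
  gate_at (G ++ map h s ++ E) (size G + i) = h (nth x0 s i).
Proof.
move=> si; rewrite /gate_at nth_cat ltnNge leq_addr /= addKn nth_cat size_map si.
by rewrite (nth_map x0).
Qed.

Definition and_of (q : nat * nat) : gate := GAnd q.1 q.2.

Lemma wf_gates_ands G (ks : seq (nat * nat)) : wf_gates G ->
  (forall q, q \in ks -> q.1 < size G /\ q.2 < size G) -> wf_gates (G ++ map and_of ks).
Proof.
move=> wfG; elim/last_ind: ks => [|ks q IH] H; first by rewrite cats0.
rewrite map_rcons -rcons_cat; apply: wf_gates_rcons => [|c].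
  by apply: IH => r rks; apply: H; rewrite mem_rcons inE rks orbT.
have [] := H q; rewrite ?mem_rcons ?mem_head // => q1 q2.
by rewrite size_cat !inE => /pred2P[]->; rewrite ltn_addr.
Qed.

(** The condition on [count] encodes disjointness and exhaustiveness of the primes at once. The new
    gates are one conjunction per pair, the [i]-th at index [size G + i], and then their
    disjunction. *)
Lemma has_sdd_or_pairs G (ks : seq (nat * nat)) vL vR : wf_gates G ->
  (forall q, q \in ks -> q.1 < size G /\ q.2 < size G) ->
  (forall q, q \in ks -> is_sdd G q.1 vL /\ is_sdd G q.2 vR) ->
  (forall q, q \in ks -> exists a, nval G a q.1) ->
  (forall a, count (fun q => nval G a q.1) ks = 1) ->
  exists E, [/\ size E <= (size ks).+1, wf_gates (G ++ E) &
    has_sdd (G ++ E) (VNode vL vR) (fun a => has (fun q => nval G a q.1 && nval G a q.2) ks)].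
Proof.
move=> wfG ksG ksT ksS ks1.
set cs := iota (size G) (size ks).
set E1 := map and_of ks; set E := E1 ++ [:: GOr cs].
have csP c : c \in cs -> exists2 i, i < size ks & c = size G + i.
  by rewrite mem_iota => H; exists (c - size G); lia.
have gE i : i < size ks -> gate_at (G ++ E) (size G + i) = and_of (nth (0, 0) ks i).
  exact: gate_at_map.
have nE q a : q \in ks ->
    nval (G ++ E) a q.1 = nval G a q.1 /\ nval (G ++ E) a q.2 = nval G a q.2.
  by move=> /ksG[? ?]; rewrite !nval_cat.
have wfGE : wf_gates (G ++ E).
  rewrite catA cats1; apply: wf_gates_rcons; first exact: wf_gates_ands.
  by move=> c; rewrite /= size_cat size_map mem_iota => /andP[].
have szE : size (G ++ E) = (size G + size ks).+1.
  by rewrite !size_cat size_map addnA addn1.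
have gO : gate_at (G ++ E) (size G + size ks) = GOr cs.
  by rewrite /gate_at catA nth_cat size_cat size_map ltnn subnn.
exists E; split=> //; first by rewrite size_cat size_map addn1.
have psE c p s : c \in cs -> gate_at (G ++ E) c = GAnd p s ->
    exists i, [/\ i < size ks, c = size G + i & nth (0, 0) ks i = (p, s)].
  move=> /csP[i ik ->]; rewrite gE // => -[<- <-]; exists i; split=> //.
  exact: surjective_pairing.
exists (size G + size ks); split; first by rewrite szE.
  apply: (@sdd_or _ _ cs _ vL vR) => //; first exact: is_subtree_refl.
  - move=> c /csP[i ik ->]; set q := nth (0, 0) ks i.
    have qks : q \in ks by apply: mem_nth.
    have [[? ?] [? ?]] := (ksG q qks, ksT q qks).
    by exists q.1, q.2; split; [rewrite gE|split; apply: is_sdd_cat].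
  - move=> c1 c2 p1 s1 p2 s2 c1cs c2cs c12 E1' E2' a.
    have [i [ik c1E iE]] := psE _ _ _ c1cs E1'; have [j [jk c2E jE]] := psE _ _ _ c2cs E2'.
    have iks := mem_nth (0, 0) ik; have jks := mem_nth (0, 0) jk.
    have /= := (nE _ a iks).1; have /= := (nE _ a jks).1; rewrite iE jE /= => -> ->.
    (* Two primes true at [a] in different positions would make the count at least 2. *)
    apply/negP=> /andP[p1a p2a]; have := ks1 a; apply/eqP; rewrite neq_ltn; apply/orP; right.
    have [ij|ji|ij] := ltngtP i j; last by rewrite c1E c2E ij eqxx in c12.
    + by apply: (nth_count_ge2 (x0 := (0, 0)) ij); rewrite ?iE ?jE.
    + by apply: (nth_count_ge2 (x0 := (0, 0)) ji); rewrite ?iE ?jE.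
  - move=> c p s ccs /(psE _ _ _ ccs)[i [ik _ iE]].
    have qks := mem_nth (0, 0) ik; have [a pa] := ksS _ qks.
    by exists a; move: pa; rewrite -(nE _ a qks).1 iE.
  - move=> a; have : has (fun q => nval G a q.1) ks by rewrite has_count ks1.
    move=> /(has_nthP (0, 0))[i ik pa].
    exists (size G + i), (nth (0, 0) ks i).1, (nth (0, 0) ks i).2.
    split; [by rewrite mem_iota leq_addr ltn_add2l|by rewrite gE|].
    by rewrite (nE _ a (mem_nth _ ik)).1.
move=> a; rewrite nvalE ?szE // gO /=.
have -> : cs = map (addn (size G)) (iota 0 (size ks)) by rewrite /cs -iotaDl addn0.
rewrite has_map -[in RHS](mkseq_nth (0, 0) ks) has_map.
apply: eq_in_has => i; rewrite mem_iota /= => ik.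
have qks := mem_nth (0, 0) ik.
rewrite -/(nval _ _ _) nvalE ?szE ?ltnS ?leq_add2l 1?ltnW // gE //= -!/(nval _ _ _).
by have [-> ->] := nE _ a qks.
Qed.

(** Finite choice by induction on the list, without a choice axiom; [b0] serves the empty list. *)
Lemma seq_choice (I : eqType) (B : Type) (b0 : B) (Q : I -> B -> Prop) (ws : seq I) :
  (forall w, w \in ws -> exists b, Q w b) -> exists h : I -> B, forall w, w \in ws -> Q w (h w).
Proof.
elim: ws => [|w ws IH] H; first by exists (fun=> b0).
have [|h hP] := IH; first by move=> x xws; apply: H; rewrite inE xws orbT.
have [b Qb] := H w (mem_head _ _).
exists (fun x => if x == w then b else h x) => x; rewrite inE.
by case: eqP => [-> _ //|_ /= /hP].
Qed.

Lemma has_sdd_or G (I : eqType) (ws : seq I) (F1 F2 : I -> (nat -> bool) -> bool) vL vR :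
  wf_gates G ->
  (forall w, w \in ws -> has_sdd G vL (F1 w)) ->
  (forall w, w \in ws -> has_sdd G vR (F2 w)) ->
  (forall w, w \in ws -> sat (F1 w)) ->
  (forall a, count (F1^~ a) ws = 1) ->
  exists E, [/\ size E <= (size ws).+1, wf_gates (G ++ E) &
    has_sdd (G ++ E) (VNode vL vR) (fun a => has (fun w => F1 w a && F2 w a) ws)].
Proof.
move=> wfG /(seq_choice 0)[k1 H1] /(seq_choice 0)[k2 H2] S1 C1.
pose ks := [seq (k1 w, k2 w) | w <- ws].
have ksP q : q \in ks -> exists2 w, w \in ws & q = (k1 w, k2 w) by case/mapP=> w; exists w.
have := @has_sdd_or_pairs G ks vL vR wfG; rewrite size_map; case.
- by move=> q /ksP[w wws ->] /=; have [[? _ _] [? _ _]] := (H1 w wws, H2 w wws).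
- by move=> q /ksP[w wws ->] /=; have [[_ ? _] [_ ? _]] := (H1 w wws, H2 w wws).
- move=> q /ksP[w wws ->] /=; have [a ?] := S1 w wws; exists a.
  by have [_ _ ->] := H1 w wws.
- move=> a; rewrite count_map -(C1 a); apply: eq_in_count => w wws /=.
  by have [_ _ ->] := H1 w wws.
move=> E [sE wfE hE]; exists E; split=> //; apply: eq_has_sdd hE => a.
rewrite has_map; apply: eq_in_has => w wws /=.
by have [[_ _ ->] [_ _ ->]] := (H1 w wws, H2 w wws).
Qed.

(** * Partitions along a vtree *)

Definition has_consts G : Prop := forall b T, has_sdd G T (fun=> b).

Lemma has_consts_cat G E : wf_gates G -> has_consts G -> has_consts (G ++ E).
Proof. by move=> wfG cG b T; apply: has_sdd_cat. Qed.

(** The primes are [p] and its negation, at the cost of two conjunctions and one disjunction. If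
    either is unsatisfiable it may not be a prime; the function is then [s] or [t] alone, an SDD of
    the right subtree. *)
Lemma has_sdd_ite G vL vR p s t : wf_gates G ->
  has_sdd G vL p -> has_sdd G vL (fun a => ~~ p a) -> has_sdd G vR s -> has_sdd G vR t ->
  exists E, [/\ size E <= 3, wf_gates (G ++ E) &
    has_sdd (G ++ E) (VNode vL vR) (fun a => if p a then s a else t a)].
Proof.
move=> wfG Hp Hn Hs Ht.
case: (classic (sat p)) => [[a1 pa1]|np]; last first.
  exists [::]; rewrite cats0; split=> //.
  apply: has_sdd_subtree (is_subtree_r _ _) _; apply: eq_has_sdd Ht => a.
  by case: ifP => // pa; case: np; exists a.
case: (classic (exists a, ~~ p a)) => [[a0 pa0]|nn]; last first.
  exists [::]; rewrite cats0; split=> //.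
  apply: has_sdd_subtree (is_subtree_r _ _) _; apply: eq_has_sdd Hs => a.
  by case: ifP => // pa; case: nn; exists a; rewrite pa.
have := @has_sdd_or G bool [:: true; false] (fun b a => if b then p a else ~~ p a)
  (fun b a => if b then s a else t a) vL vR wfG.
case; try by case.
- by case=> _; [exists a1|exists a0].
- by move=> a /=; case: (p a).
move=> E [sE wfE hE]; exists E; split=> //; apply: eq_has_sdd hE => a /=.
by case: (p a); rewrite ?orbF.
Qed.

(** A function of one variable is a constant or a literal, whose polarity is its value at [x]
    true. *)
Lemma has_sdd_leaf G x g : wf_gates G -> has_consts G ->
  (forall a b, a x = b x -> g a = g b) ->
  exists E, [/\ size E <= 1, wf_gates (G ++ E) & has_sdd (G ++ E) (VLeaf x) g].
Proof.
move=> wfG cG gx.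
have gE a : g a = if a x then g (fun=> true) else g (fun=> false).
  by case: ifP => ax; apply: gx.
case: (eqVneq (g (fun=> true)) (g (fun=> false))) => [g01|g01].
  exists [::]; rewrite cats0; split=> //.
  by apply: eq_has_sdd (cG (g (fun=> true)) _) => a; rewrite [RHS]gE g01 if_same.
exists [:: GLit x (g (fun=> true))].
have wfE : wf_gates (G ++ [:: GLit x (g (fun=> true))]).
  by rewrite cats1; apply: wf_gates_rcons.
have gG : gate_at (G ++ [:: GLit x (g (fun=> true))]) (size G) = GLit x (g (fun=> true)).
  by rewrite /gate_at nth_cat ltnn subnn.
split=> //; exists (size G); split; first by rewrite size_cat addn1.
  by apply: sdd_lit gG _; rewrite inE.
move=> a; rewrite nvalE ?size_cat ?addn1 // gG /= [RHS]gE.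
by move: g01; case: (g (fun=> true)); case: (g (fun=> false)); case: (a x).
Qed.

(** The elements are served one after another: [E0] is what earlier ones have appended, and [Q]
    survives later appending. *)
Lemma extend_all G (A : eqType) (ws : seq A) c (Q : A -> seq gate -> Prop) :
  wf_gates G ->
  (forall w G' E, wf_gates G' -> Q w G' -> Q w (G' ++ E)) ->
  (forall w E0, w \in ws -> wf_gates (G ++ E0) ->
     exists E, [/\ size E <= c, wf_gates ((G ++ E0) ++ E) & Q w ((G ++ E0) ++ E)]) ->
  exists E, [/\ size E <= c * size ws, wf_gates (G ++ E) & forall w, w \in ws -> Q w (G ++ E)].
Proof.
move=> wfG Qcat; elim: ws => [|w ws IH] H; first by exists [::]; rewrite cats0.
have [|E1 [s1 wf1 Q1]] := IH; first by move=> x E0 xws; apply: H; rewrite inE xws orbT.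
have [E2 [s2 wf2 Q2]] := H w E1 (mem_head _ _) wf1.
exists (E1 ++ E2); rewrite catA; split=> //; first by rewrite size_cat /= mulnS addnC leq_add.
by move=> x; rewrite inE => /predU1P[-> //|/Q1]; exact: Qcat.
Qed.

Definition is_vleaf t := if t is VLeaf _ then true else false.

(* The leaf [M + head 0 (vleaves r)] is the auxiliary variable of the node: each leaf of a vtree
   but the leftmost is the first leaf of exactly one right child. *)
Fixpoint aug_vtree M t : vtree :=
  match t with
  | VLeaf x => VLeaf x
  | VNode l r =>
      let t' := VNode (aug_vtree M l) (aug_vtree M r) in
      if is_vleaf l && is_vleaf r then t' else VNode t' (VLeaf (M + head 0 (vleaves r)))
  end.

Section Compile.
Variables (I : eqType) (val : I -> (nat -> bool) -> bool) (vars : I -> seq nat).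
Variables (L : seq I) (T : vtree) (M : nat) (top : I).

Definition splits (X Y : seq nat) w (ps : I * I) : Prop :=
  [/\ ps.1 \in L, ps.2 \in L, {subset vars ps.1 <= X}, {subset vars ps.2 <= Y} &
      forall a, val w a = val ps.1 a && val ps.2 a].

(** The invariant that is carried down the vtree. Unlike the primes of an SDD, members may be
    unsatisfiable, since already [f] may be constant. *)
Definition in_partition (X : seq nat) u : Prop :=
  exists P, [/\ u \in P, forall w, w \in P -> w \in L /\ {subset vars w <= X} &
                forall a, count (val^~ a) P = 1].

Definition rectangle X Y w : Prop :=
  [/\ w \in L, sat (val w) & exists ps, splits X Y w ps].

(** The truth value of [u] is read as a number, so one equation states that the rectangles are
    disjoint and cover exactly [u]; such equations add up under concatenation. *)
Definition decomposes X Y u (ws : seq I) : Prop :=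
  (forall w, w \in ws -> rectangle X Y w) /\ forall a, count (val^~ a) ws = val u a.

Hypothesis uniqT : uniq (vleaves T).
Hypothesis val_local : forall u a b, u \in L -> {in vars u, a =1 b} -> val u a = val u b.
Hypothesis topL : top \in L.
Hypothesis vars_top : vars top = [::].
Hypothesis val_top : forall a, val top a.
Hypothesis decomp : forall l r u, is_subtree (VNode l r) T -> u \in L ->
  {subset vars u <= vleaves l ++ vleaves r} ->
  exists ws, decomposes (vleaves l) (vleaves r) u ws.

(* Fix an assignment [b] satisfying the second factor of [w]: the first factors of the rectangles
   whose second factor holds at [b] form a partition over [X]. *)
Lemma in_partition_left X Y P w ps : (forall x, x \in X -> x \notin Y) ->
  (forall x, x \in P -> exists qs, splits X Y x qs) -> (forall a, count (val^~ a) P = 1) ->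
  w \in P -> sat (val w) -> splits X Y w ps -> in_partition X ps.1.
Proof.
move=> dis /(seq_choice ps)[h hP] P1 wP [b wb] wps.
(* [h] picks an arbitrary splitting of each rectangle; at [w] it must be the given one, so that
   [ps.1] becomes a member. *)
pose k x := if x == w then ps else h x.
have kP x : x \in P -> splits X Y x (k x) by rewrite /k; case: eqP => [-> _|_ /hP].
exists [seq (k x).1 | x <- P & val (k x).2 b]; split.
- apply/mapP; exists w; rewrite /k ?eqxx // mem_filter eqxx wP andbT.
  by case: wps wb => _ _ _ _ -> /andP[].
- by move=> _ /mapP[x + ->]; rewrite mem_filter => /andP[_ /kP[]].
(* At [a'], which is [a] on [X] and [b] elsewhere, a rectangle holds iff its first factor holds at
   [a] and its second at [b]. *)
move=> a; pose a' x := if x \in X then a x else b x.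
rewrite count_map count_filter -(P1 a'); apply: eq_in_count => x /kP[k1 k2 sX sY ->] /=.
congr (_ && _); apply: val_local => // y; rewrite /a'; first by move/sX=> ->.
by move/sY; case: ifP => // /dis /negP.
Qed.

Lemma splits_sym X Y w p s : splits X Y w (p, s) -> splits Y X w (s, p).
Proof. by case=> /= ? ? ? ? E; split=> // a; rewrite andbC. Qed.

Lemma in_partition_splits X Y P w ps : (forall x, x \in X -> x \notin Y) ->
  (forall x, x \in P -> exists qs, splits X Y x qs) -> (forall a, count (val^~ a) P = 1) ->
  w \in P -> sat (val w) -> splits X Y w ps -> in_partition X ps.1 /\ in_partition Y ps.2.
Proof.
move=> dis HP P1 wP ws wps; split; first exact: (in_partition_left dis HP P1 wP ws wps).
case: ps wps => p s wps.
apply: (in_partition_left (Y := X) (P := P) (w := w) (ps := (s, p))) => //.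
- by move=> x; apply: contraL => /dis.
- by move=> x /HP[[q t] /splits_sym]; exists (t, q).
- exact: splits_sym.
Qed.

Lemma rectangle_splits X Y w : rectangle X Y w -> exists qs, splits X Y w qs.
Proof. by case. Qed.

Lemma decomposes_seq X Y Q : (forall x, x \in Q -> exists ws, decomposes X Y x ws) ->
  exists ws, (forall w, w \in ws -> rectangle X Y w) /\
    forall a, count (val^~ a) ws = count (val^~ a) Q.
Proof.
elim: Q => [|x Q IH] HQ; first by exists [::].
have [|ws [wsR wsE]] := IH; first by move=> y yQ; apply: HQ; rewrite inE yQ orbT.
have [wx [wxR wxE]] := HQ x (mem_head _ _).
exists (wx ++ ws); split; last by move=> a; rewrite count_cat wxE wsE.
by move=> w; rewrite mem_cat => /orP[/wxR|/wsR].
Qed.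

(** Decomposing the other members of the partition of [u] yields rectangles covering the negation of
    [u], which complete [ws] to a partition. *)
Lemma decomposes_rest X Y u ws :
  (forall x, x \in L -> {subset vars x <= X ++ Y} -> exists ws, decomposes X Y x ws) ->
  in_partition (X ++ Y) u -> decomposes X Y u ws ->
  exists rest, (forall w, w \in rest -> rectangle X Y w) /\
    forall a, count (val^~ a) ws + count (val^~ a) rest = 1.
Proof.
move=> dec [P [uP PL P1]] [wsR wsu].
(* [rem] drops a single occurrence, so the counts match even if [u] is unsatisfiable and listed
   repeatedly. *)
have [|rest [restR restE]] := @decomposes_seq X Y (rem u P).
  by move=> x /mem_rem /PL[]; exact: dec.
exists rest; split=> // a; rewrite wsu restE -(P1 a).
by rewrite (permP (perm_to_rem uP)).
Qed.

(** A satisfiable member listed twice would be counted twice where it holds. Hence a partition by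
    rectangles has at most [size L] members. *)
Lemma uniq_partition (P : seq I) : (forall w, w \in P -> sat (val w)) ->
  (forall a, count (val^~ a) P = 1) -> uniq P.
Proof.
move=> Ps P1; apply: count_mem_uniq => w.
case wP: (w \in P); last by apply/count_memPn; rewrite wP.
have [a wa] := Ps w wP; apply/eqP; rewrite eqn_leq -has_count has_pred1 wP andbT /= -(P1 a).
by apply: sub_count => x /= /eqP ->.
Qed.

(** Both signs are carried along because the primes of a rectangle are its first factor and the
    negation of that factor. *)
Definition sdd_pair v G u : Prop :=
  has_sdd G v (val u) /\ has_sdd G v (fun a => ~~ val u a).

Lemma sdd_pair_cat v G E u : wf_gates G -> sdd_pair v G u -> sdd_pair v (G ++ E) u.
Proof. by move=> wfG [? ?]; split; apply: has_sdd_cat. Qed.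

Lemma sdd_pair_subtree t v G u : is_subtree t v -> sdd_pair t G u -> sdd_pair v G u.
Proof. by move=> sub [? ?]; split; apply: has_sdd_subtree sub _. Qed.

Lemma sdd_pair_const v G u b : has_consts G -> (forall a, val u a = b) -> sdd_pair v G u.
Proof.
move=> cG ub; split; [apply: eq_has_sdd (cG b v)|apply: eq_has_sdd (cG (~~ b) v)] => a;
  by rewrite ub.
Qed.

(* The primes are the rectangles partitioning the assignments of the node, the subs are constants
   over the auxiliary variable [h]. *)
Lemma extend_node X Y Tl Tr h G u ws : wf_gates G -> has_consts G ->
  (forall x, x \in X -> x \notin Y) ->
  (forall x, x \in L -> {subset vars x <= X ++ Y} -> exists ws, decomposes X Y x ws) ->
  (forall x, in_partition X x -> sdd_pair Tl G x) ->
  (forall x, in_partition Y x -> sdd_pair Tr G x) ->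
  in_partition (X ++ Y) u -> decomposes X Y u ws ->
  exists E, [/\ size E <= 5 * size L + 2, wf_gates (G ++ E) &
    sdd_pair (VNode (VNode Tl Tr) (VLeaf h)) (G ++ E) u].
Proof.
move=> wfG cG dis dec Hl Hr uP uws.
have [rest [restR C1]] := decomposes_rest dec uP uws.
have [wsR wsE] := uws.
set P := ws ++ rest.
have PR w : w \in P -> rectangle X Y w by rewrite mem_cat => /orP[/wsR|/restR].
have P1 a : count (val^~ a) P = 1 by rewrite count_cat.
have Ps w : w \in P -> sat (val w) by move=> /PR[].
have szP : size P <= size L.
  by apply: uniq_leq_size => [|w /PR[]//]; apply: uniq_partition.
have [||E1 [s1 wf1 H1]] := @extend_all G I P 3 (fun w G' => has_sdd G' (VNode Tl Tr) (val w)) wfG.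
- by move=> w G' E wfG'; apply: has_sdd_cat.
- move=> w E0 wP wf0; have [_ wsat [ps wps]] := PR w wP.
  have [pP sP] := in_partition_splits dis (fun x xP => rectangle_splits (PR x xP)) P1 wP wsat wps.
  have [/(has_sdd_cat E0 wfG) p1 /(has_sdd_cat E0 wfG) p0] := Hl _ pP.
  have [/(has_sdd_cat E0 wfG) t1 _] := Hr _ sP.
  have [E [sE wfE hE]] := has_sdd_ite wf0 p1 p0 t1 (has_consts_cat E0 wfG cG false Tr).
  exists E; split=> //; apply: eq_has_sdd hE => a.
  by have [_ _ _ _ ->] := wps; case: (val ps.1 a).
have cG1 := has_consts_cat E1 wfG cG.
have [E2 [s2 wf2 H2]] := has_sdd_or wf1 (F2 := fun w _ => w \in ws)
  (vR := VLeaf h) H1 (fun w _ => cG1 _ _) Ps P1.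
have H1' w : w \in P -> has_sdd ((G ++ E1) ++ E2) (VNode Tl Tr) (val w).
  by move=> /H1; apply: has_sdd_cat.
have cG2 := has_consts_cat E2 wf1 cG1.
have [E3 [s3 wf3 H3]] := has_sdd_or wf2 (F2 := fun w _ => w \notin ws)
  (vR := VLeaf h) H1' (fun w _ => cG2 _ _) Ps P1.
(* With at most [size L] rectangles: 3 gates for each, then one more per rectangle and a disjunction
   for each of [u] and its negation. *)
exists (E1 ++ E2 ++ E3); rewrite !catA; split=> //.
  by rewrite !size_cat; lia.
have wsP a w : w \in ws -> val w a -> val u a.
  move=> wws wa; have := wsE a; case: (val u a) => // /eqP.
  by rewrite -leqn0 leqNgt -has_count => /hasPn/(_ w wws); rewrite wa.
have restP a w : w \in rest -> val w a -> ~~ val u a.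
  move=> wr wa; have := C1 a; rewrite wsE.
  have : 0 < count (val^~ a) rest by rewrite -has_count; apply/hasP; exists w.
  by case: (val u a) => //; lia.
have exP a : exists2 w, w \in P & val w a by apply/hasP; rewrite has_count P1.
split.
  apply: has_sdd_cat => //; apply: eq_has_sdd H2 => a.
  apply/hasP/idP => [[w _ /andP[wa wws]]|ua]; first exact: wsP wa.
  have [w wP wa] := exP a; exists w => //; rewrite wa /=.
  move: wP; rewrite mem_cat => /orP[//|wr].
  by have := restP _ _ wr wa; rewrite ua.
apply: eq_has_sdd H3 => a.
apply/hasP/idP => [[w wP /andP[wa wws]]|ua].
  by move: wP; rewrite mem_cat (negPf wws) => /restP; apply.
have [w wP wa] := exP a; exists w => //; rewrite wa /=.
by apply: contra ua => /wsP; apply.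
Qed.

(** * Vtree nodes with one or two leaves *)

Lemma extend_leaf x G u : wf_gates G -> has_consts G -> u \in L ->
  {subset vars u <= [:: x]} ->
  exists E, [/\ size E <= 2, wf_gates (G ++ E) & sdd_pair (VLeaf x) (G ++ E) u].
Proof.
move=> wfG cG uL ux.
have loc a b : a x = b x -> val u a = val u b.
  by move=> ab; apply: val_local => // y /ux; rewrite inE => /eqP ->.
have [E1 [s1 wf1 H1]] := has_sdd_leaf wfG cG loc.
have [|E2 [s2 wf2 H2]] := has_sdd_leaf (g := fun a => ~~ val u a) (x := x) wf1
  (has_consts_cat E1 wfG cG); first by move=> a b /loc ->.
exists (E1 ++ E2); rewrite catA; split=> //; first by rewrite size_cat; lia.
by split=> //; apply: has_sdd_cat.
Qed.

(** Shannon expansion on [x]: two literals of [x], at most one gate for each cofactor, a function of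
    [y], and 3 gates to combine them. No fresh leaf is used. *)
Lemma has_sdd_two_leaves x y G g : x != y -> wf_gates G -> has_consts G ->
  (forall a b, a x = b x -> a y = b y -> g a = g b) ->
  exists E, [/\ size E <= 7, wf_gates (G ++ E) &
    has_sdd (G ++ E) (VNode (VLeaf x) (VLeaf y)) g].
Proof.
move=> xy wfG cG gxy.
have [|E1 [s1 wf1 H1]] := @has_sdd_leaf G x (fun a => a x) wfG cG; first by [].
have cG1 := has_consts_cat E1 wfG cG.
have [|E2 [s2 wf2 H2]] := @has_sdd_leaf _ x (fun a => ~~ a x) wf1 cG1; first by move=> a b ->.
have cG2 := has_consts_cat E2 wf1 cG1.
pose c b (a : nat -> bool) z := if z == x then b else a z.
have cloc b a a' : a y = a' y -> g (c b a) = g (c b a').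
  by move=> ya; apply: gxy; rewrite /c ?eqxx // eq_sym (negPf xy).
have [|E3 [s3 wf3 H3]] := @has_sdd_leaf _ y (fun a => g (c true a)) wf2 cG2; first exact: cloc.
have cG3 := has_consts_cat E3 wf2 cG2.
have [|E4 [s4 wf4 H4]] := @has_sdd_leaf _ y (fun a => g (c false a)) wf3 cG3; first exact: cloc.
have [||||E5 [s5 wf5 H5]] := has_sdd_ite wf4 (vL := VLeaf x) (vR := VLeaf y)
  (p := fun a => a x) (s := fun a => g (c true a)) (t := fun a => g (c false a)).
- by do 3!(apply: has_sdd_cat => //).
- by do 2!(apply: has_sdd_cat => //).
- by apply: has_sdd_cat.
- by [].
exists (E1 ++ E2 ++ E3 ++ E4 ++ E5); rewrite !catA; split=> //.
  by rewrite !size_cat; lia.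
apply: eq_has_sdd H5 => a.
by case: ifP => ax; apply: gxy; rewrite /c ?eqxx // eq_sym (negPf xy).
Qed.

Lemma extend_two_leaves x y G u : x != y -> wf_gates G -> has_consts G -> u \in L ->
  {subset vars u <= [:: x; y]} ->
  exists E, [/\ size E <= 14, wf_gates (G ++ E) &
    sdd_pair (VNode (VLeaf x) (VLeaf y)) (G ++ E) u].
Proof.
move=> xy wfG cG uL uxy.
have loc a b : a x = b x -> a y = b y -> val u a = val u b.
  by move=> ax ay; apply: val_local => // z /uxy; rewrite !inE => /pred2P[]->.
have [E1 [s1 wf1 H1]] := has_sdd_two_leaves xy wfG cG loc.
have [|E2 [s2 wf2 H2]] := has_sdd_two_leaves (g := fun a => ~~ val u a) xy wf1
  (has_consts_cat E1 wfG cG); first by move=> a b ax ay; rewrite (loc a b).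
exists (E1 ++ E2); rewrite catA; split=> //; first by rewrite size_cat; lia.
by split=> //; apply: has_sdd_cat.
Qed.

(* A gate with variables either straddles exactly one inner vtree node or mentions one variable only,
   so that the costs, linear per gate, sum up to a quadratic bound. *)
Definition within (X : seq nat) u := (vars u != [::]) && all (mem X) (vars u).

Definition straddles (X Y : seq nat) u :=
  [&& all (mem (X ++ Y)) (vars u), ~~ all (mem X) (vars u) & ~~ all (mem Y) (vars u)].

(** The three classes exclude each other; for the first two this rests on the nonempty variable list
    in [within]. *)
Lemma count_within X Y : (forall x, x \in X -> x \notin Y) ->
  count (within X) L + count (within Y) L + count (straddles X Y) L <= count (within (X ++ Y)) L.
Proof.
move=> dis; elim: L => //= u K IH.
suff le : within X u + within Y u + straddles X Y u <= within (X ++ Y) u.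
  apply: leq_trans (leq_add le IH).
  by rewrite [in leqRHS]addnACA leq_add2r [in leqRHS]addnACA.
have subX : all (mem X) (vars u) -> all (mem (X ++ Y)) (vars u).
  by apply: sub_all => x /= xX; rewrite mem_cat xX.
have subY : all (mem Y) (vars u) -> all (mem (X ++ Y)) (vars u).
  by apply: sub_all => x /= xY; rewrite mem_cat xY orbT.
have disXY : all (mem X) (vars u) -> all (mem Y) (vars u) -> vars u = [::].
  case: (vars u) => //= x s /andP[xX _] /andP[xY _].
  by have := dis x xX; rewrite xY.
rewrite /within /straddles; case: eqP => [->|nz] //=.
move: subX subY disXY; case: (all (mem X) _); case: (all (mem Y) _);
  case: (all (mem (X ++ Y)) _) => //= a b c;
  by [case: nz; apply: c|have := a isT|have := b isT].
Qed.

(** Bottom-up over the vtree: only gates straddling the children of [v] are built at [v], while a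
    gate living on one side is inherited from that child. Each gate with variables is thus charged
    [5 * size L + 14] at most once; gates without variables are constants. *)
Lemma compile_vtree v : is_subtree v T -> forall G, wf_gates G -> has_consts G ->
  exists E, [/\ size E <= (5 * size L + 14) * count (within (vleaves v)) L, wf_gates (G ++ E) &
    forall u, in_partition (vleaves v) u -> sdd_pair (aug_vtree M v) (G ++ E) u].
Proof.
elim: v => [x|l IHl r IHr] vT G wfG cG.
  have [||E [sE wfE HE]] := @extend_all G I (filter (within [:: x]) L) 2
      (fun u G' => sdd_pair (VLeaf x) G' u) wfG.
  - by move=> w G' E; apply: sdd_pair_cat.
  - move=> w E0; rewrite mem_filter => /andP[/andP[_ /allP wx] wL] wf0.
    by apply: extend_leaf => //; apply: has_consts_cat.
  exists E; split=> //.
    rewrite (leq_trans sE) // size_filter leq_mul2r; apply/orP; right; lia.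
  move=> u [P [/[swap] PL + _]] => /PL[uL ux] /=.
  case: (boolP (within [:: x] u)) => [wu|]; first by apply: HE; rewrite mem_filter wu.
  rewrite /within negb_and negbK => /orP[/eqP u0|/allP[]//].
  apply: (@sdd_pair_const _ _ _ (val u (fun=> true))); first exact: has_consts_cat.
  by move=> a; apply: val_local => // z; rewrite u0.
set X := vleaves l; set Y := vleaves r.
have dis x : x \in X -> x \notin Y.
  have /= := uniq_subtree vT uniqT; rewrite cat_uniq => /and3P[_ /hasPn H _].
  by apply: contraL => /H.
have [E1 [s1 wf1 H1]] := IHl (is_subtree_trans (is_subtree_l _ _) vT) G wfG cG.
have cG1 := has_consts_cat E1 wfG cG.
have [E2 [s2 wf2 H2]] := IHr (is_subtree_trans (is_subtree_r _ _) vT) _ wf1 cG1.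
have cG2 := has_consts_cat E2 wf1 cG1.
have Hl u : in_partition X u -> sdd_pair (aug_vtree M l) ((G ++ E1) ++ E2) u.
  by move/H1; apply: sdd_pair_cat.
set G2 := (G ++ E1) ++ E2 in wf2 cG2 H2 Hl.
have decv u := decomp vT (u := u).
have [||E3 [s3 wf3 H3]] := @extend_all G2 I (filter (straddles X Y) L) (5 * size L + 14)
    (fun u G' => in_partition (X ++ Y) u -> sdd_pair (aug_vtree M (VNode l r)) G' u) wf2.
- by move=> w G' E wfG' Q /Q; apply: sdd_pair_cat.
- move=> u E0; rewrite mem_filter => /andP[/andP[/allP uv _] uL] wf0.
  have cG0 := has_consts_cat E0 wf2 cG2.
  (* Gates outside every partition get no SDD, and nothing is appended for them. *)
  case: (classic (in_partition (X ++ Y) u)) => [uP|nP]; last first.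
    by exists [::]; rewrite cats0; split.
  have [ws uws] := decv u uL uv.
  have [||E [sE wfE HE]] := @extend_node X Y (aug_vtree M l) (aug_vtree M r)
    (M + head 0 Y) _ u ws wf0 cG0 dis decv _ _ uP uws.
  + by move=> x /Hl; apply: sdd_pair_cat.
  + by move=> x /H2; apply: sdd_pair_cat.
  (* The extension just obtained uses the fresh leaf. Above two leaves [aug_vtree] has none, and the
     direct construction replaces it. *)
  + rewrite /=; case: ifP => [/andP[lx ry]|_]; last by exists E; split=> //; lia.
    have [x lE] : exists x, l = VLeaf x by case: (l) lx => // x; exists x.
    have [y rE] : exists y, r = VLeaf y by case: (r) ry => // y; exists y.
    have xy : x != y by have := dis x; rewrite /X /Y lE rE !inE eqxx; apply.
    have uxy : {subset vars u <= [:: x; y]} by move=> z /uv; rewrite /X /Y lE rE.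
    have [E' [sE' wfE' HE']] := extend_two_leaves xy wf0 cG0 uL uxy.
    by exists E'; split=> //; [lia|rewrite lE rE].
exists (E1 ++ E2 ++ E3); rewrite !catA; split=> //.
  rewrite !size_cat; apply: leq_trans (leq_mul (leqnn _) (count_within dis)).
  by rewrite !mulnDr leq_add ?leq_add // -size_filter.
move=> u uP; have [P [uP' PL P1]] := uP; have [uL uv] := PL u uP'.
case: (boolP (straddles X Y u)) => [su|].
  by apply: H3 => //; rewrite mem_filter su.
case: (classic (sat (val u))) => [us|nu]; last first.
  move=> _; apply: (@sdd_pair_const _ _ _ false); first exact: has_consts_cat.
  by move=> a; apply/negP => ua; apply: nu; exists a.
have auglr : is_subtree (VNode (aug_vtree M l) (aug_vtree M r)) (aug_vtree M (VNode l r)).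
  by rewrite /=; case: ifP => _; [exact: is_subtree_refl|exact: is_subtree_l].
(* A satisfiable [u] that splits is its own decomposition, so it lies in a partition by rectangles
   and its factors lie in partitions at the children. With [top] as one factor this passes [u]
   itself to a child. *)
have main ps : splits X Y u ps -> in_partition X ps.1 /\ in_partition Y ps.2.
  move=> ups; have uR : rectangle X Y u by split=> //; exists ps.
  have uu : decomposes X Y u [:: u].
    by split=> [w|a]; [rewrite inE => /eqP ->|rewrite /= addn0].
  have [rest [restR C1]] := decomposes_rest decv uP uu.
  apply: (in_partition_splits (P := u :: rest) (w := u)) => //; last exact: mem_head.
    by move=> x; rewrite inE => /predU1P[->|/restR/rectangle_splits //]; exists ps.
  by move=> a; rewrite -(C1 a) /= addn0.
have -> : straddles X Y u = ~~ all (mem X) (vars u) && ~~ all (mem Y) (vars u).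
  by rewrite /straddles (introT allP (uv : {in vars u, forall x, x \in X ++ Y})).
rewrite negb_and !negbK => /orP[]/allP uX.
  have [|uPX _] := main (u, top); first by split=> //= [x|a]; rewrite ?vars_top ?val_top ?andbT.
  apply: sdd_pair_cat => //; apply: sdd_pair_subtree (Hl _ uPX).
  exact: is_subtree_trans (is_subtree_l _ _) auglr.
have [|_ uPY] := main (top, u); first by split=> //= [x|a]; rewrite ?vars_top ?val_top.
apply: sdd_pair_cat => //; apply: sdd_pair_subtree (H2 _ uPY).
exact: is_subtree_trans (is_subtree_r _ _) auglr.
Qed.

End Compile.

(** * Auxiliary variables and families of circuits *)

(** The labels whose shifts by [M] are the fresh leaves of [aug_vtree M t]. *)
Fixpoint aux_leaves t : seq nat :=
  match t with
  | VLeaf _ => [::]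
  | VNode l r => aux_leaves l ++ aux_leaves r ++
      (if is_vleaf l && is_vleaf r then [::] else [:: head 0 (vleaves r)])
  end.

Lemma vleaves_aug M t :
  perm_eq (vleaves (aug_vtree M t)) (vleaves t ++ [seq M + x | x <- aux_leaves t]).
Proof.
elim: t => [x|l IHl r IHr] //=.
have IH : perm_eq (vleaves (aug_vtree M l) ++ vleaves (aug_vtree M r))
  ((vleaves l ++ vleaves r) ++ [seq M + x | x <- aux_leaves l ++ aux_leaves r]).
  rewrite (perm_trans (perm_cat IHl IHr)) // map_cat -!catA perm_cat2l.
  by rewrite perm_catCA.
case: ifP => _ /=; first by rewrite cats0.
by rewrite catA map_cat catA perm_cat2r.
Qed.

Lemma vleaves_cons t : vleaves t = head 0 (vleaves t) :: behead (vleaves t).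
Proof. by elim: t => [x|l IHl r _] //=; rewrite IHl. Qed.

(** The first leaf of a right child is never the leftmost leaf of the whole tree. Hence the label
    chosen at a node does not reappear inside its right child, which gives uniqueness. *)
Lemma aux_leaves_sub t : {subset aux_leaves t <= behead (vleaves t)}.
Proof.
elim: t => [x|l IHl r IHr] //= x; rewrite !mem_cat [vleaves l]vleaves_cons /= mem_cat.
case/or3P=> [/IHl ->//|/IHr/mem_behead ->|]; first by rewrite orbT.
case: ifP => // _; rewrite inE => /eqP ->.
by rewrite [vleaves r]vleaves_cons mem_head orbT.
Qed.

Lemma aux_leaves_uniq t : uniq (vleaves t) -> uniq (aux_leaves t).
Proof.
elim: t => [x|l IHl r IHr] //=; rewrite cat_uniq => /and3P[ul /hasPn dis ur].
have rP x : x \in aux_leaves r ++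
    (if is_vleaf l && is_vleaf r then [::] else [:: head 0 (vleaves r)]) -> x \in vleaves r.
  rewrite mem_cat => /orP[/aux_leaves_sub/mem_behead//|].
  by case: ifP => // _; rewrite inE => /eqP ->; rewrite [vleaves r]vleaves_cons mem_head.
rewrite cat_uniq IHl //=; apply/andP; split.
  apply/hasPn => x /rP /dis; apply: contra => /aux_leaves_sub; exact: mem_behead.
case: ifP => _; first by rewrite cats0 IHr.
rewrite cats1 rcons_uniq IHr // andbT; apply/negP => /aux_leaves_sub.
by move: ur; rewrite [vleaves r]vleaves_cons /= => /andP[/negP].
Qed.

(** One and two leaves give 0. Joining a leaf to a larger tree adds one leaf and one label; joining
    two inner nodes leaves a slack of one. *)
Lemma size_aux_leaves t : size (aux_leaves t) <= size (vleaves t) - 2.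
Proof.
have pos s : 0 < size (vleaves s) by rewrite vleaves_cons.
have pos2 s : ~~ is_vleaf s -> 1 < size (vleaves s).
  by case: s => // l r _ /=; rewrite size_cat; have := pos l; have := pos r; lia.
have leaf0 s : is_vleaf s -> size (aux_leaves s) = 0 by case: s.
elim: t => [x|l IHl r IHr] //=; rewrite !size_cat.
have := pos l; have := pos r; have := pos2 l; have := pos2 r.
have := leaf0 l; have := leaf0 r.
case: (is_vleaf l); case: (is_vleaf r) => /= a b c d; try have := a isT; try have := b isT;
  try have := c isT; try have := d isT; lia.
Qed.

Lemma count_le1 (A : eqType) (P : pred A) s : uniq s ->
  (forall x y, x \in s -> y \in s -> x != y -> ~~ (P x && P y)) -> count P s <= 1.
Proof.
move=> us H; rewrite -size_filter; have := filter_uniq P us.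
case E: (filter P s) => [//|x [//|y t]] /= /andP[+ _].
rewrite inE negb_or => /andP[xy _].
have xP : x \in filter P s by rewrite E mem_head.
have yP : y \in filter P s by rewrite E !inE eqxx orbT.
move: xP yP; rewrite !mem_filter => /andP[Px xs] /andP[Py ys].
by have := H x y xs ys xy; rewrite Px Py.
Qed.

(** * Gates of several circuits, addressed by circuit and gate index *)

Section Family.
Variables (C : nat -> nnf) (T : vtree) (L : seq (nat * nat)) (top : nat * nat).

Definition gval (u : nat * nat) a := nval (gates (C u.1)) a u.2.
Definition gvars (u : nat * nat) := nvars (gates (C u.1)) u.2.

Hypothesis uniqT : uniq (vleaves T).
Hypothesis wfC : forall i, wf_gates (gates (C i)).
Hypothesis detC : forall i, deterministic (C i).
Hypothesis strC : forall i, structured (C i) T.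
Hypothesis L_lt : forall u, u \in L -> u.2 < size (gates (C u.1)).
Hypothesis L_closed : forall u c, u \in L -> c < u.2 -> (u.1, c) \in L.
Hypothesis topL : top \in L.
Hypothesis vars_top : gvars top = [::].
Hypothesis val_top : forall a, gval top a.

Lemma gval_local u a b : u \in L -> {in gvars u, a =1 b} -> gval u a = gval u b.
Proof. by move=> uL; apply: eq_in_nval => //; apply: L_lt. Qed.

Lemma gval_true u : u \in L -> sat (gval u) -> gvars u = [::] -> forall a, gval u a.
Proof. by move=> uL [b ub] u0 a; rewrite (@gval_local u a b) // u0. Qed.

(* An and-gate meeting both sides of a node [v] either respects [v] itself or respects a node above
   [v], and then one of its children has no variables. *)
Lemma gate_decomposes l r u : is_subtree (VNode l r) T -> u \in L ->
  {subset gvars u <= vleaves l ++ vleaves r} ->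
  exists ws, decomposes gval gvars L (vleaves l) (vleaves r) u ws.
Proof.
move=> vT; case: u => i k; elim/ltn_ind: k => k IH uL uv.
set u := (i, k) in uL uv *.
have kC := L_lt uL; rewrite /= in kC.
case: (classic (sat (gval u))) => [us|nu]; last first.
  exists [::]; split=> // a; case ua: (gval u a) => //; case: nu.
  by exists a.
have single ps : splits gval gvars L (vleaves l) (vleaves r) u ps ->
    exists ws, decomposes gval gvars L (vleaves l) (vleaves r) u ws.
  move=> ups; exists [:: u]; split=> [w|a]; last by rewrite /= addn0.
  by rewrite inE => /eqP ->; split=> //; exists ps.
case: (boolP (all (mem (vleaves l)) (gvars u))) => [/allP ul|nul].
  by apply: (single (u, top)); split=> //= [x|a]; rewrite ?vars_top ?val_top ?andbT.
case: (boolP (all (mem (vleaves r)) (gvars u))) => [/allP ur|nur].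
  by apply: (single (top, u)); split=> //= [x|a]; rewrite ?vars_top ?val_top.
have uvE := nvarsE (@wfC i) kC.
have chL c : c \in children (gate_at (gates (C i)) k) ->
    [/\ c < k, (i, c) \in L & {subset gvars (i, c) <= gvars u}].
  move=> ck; have lck := wfC kC ck; split=> //; first exact: (L_closed uL).
  exact: sub_nvars_children.
case E: (gate_at (gates (C i)) k) uvE chL => [b|x p|p s|cs] uvE chL.
- by rewrite /gvars uvE in nul.
- have : x \in vleaves l ++ vleaves r by apply: uv; rewrite /gvars /= uvE inE.
  by move: nul nur; rewrite /gvars /= uvE /= !andbT mem_cat => /negPf -> /negPf ->.
- have [pk pL pu] := chL p (mem_head _ _).
  have [|sk sL su] := chL s; first by rewrite !inE eqxx orbT.
  have uE a : gval u a = gval (i, p) a && gval (i, s) a by rewrite /gval nvalE //= E.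
  have uE0 x : x \in gvars u -> x \in gvars (i, p) \/ x \in gvars (i, s).
    by rewrite /gvars uvE /= mem_cat => /orP.
  have psat : sat (gval (i, p)) by have [a] := us; rewrite uE => /andP[pa _]; exists a.
  have ssat : sat (gval (i, s)) by have [a] := us; rewrite uE => /andP[_ sa]; exists a.
  have [w [wT]] := strC kC E.
  case: w wT => [//|wl wr] wT [/= pwl swr].
  have uw x : x \in gvars u -> x \in vleaves (VNode wl wr).
    by rewrite /= mem_cat => /uE0[/pwl ->|/swr ->]; rewrite ?orbT.
  have wdis x : x \in vleaves wl -> x \in vleaves wr -> False.
    have /= := uniq_subtree wT uniqT; rewrite cat_uniq => /and3P[_ /hasPn H _] xl /H.
    by rewrite xl.
  (* For the case that the other factor has no variables: being satisfiable it is true, and [u]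
     computes the same function as its child [c]. *)
  have lift c : c < k -> (i, c) \in L -> {subset gvars (i, c) <= gvars u} ->
      (forall a, gval u a = gval (i, c) a) ->
      exists ws, decomposes gval gvars L (vleaves l) (vleaves r) u ws.
    move=> ck cL cu cE; have [|ws [wsR wsE]] := IH c ck cL; first by move=> x /cu /uv.
    by exists ws; split=> // a; rewrite wsE cE.
  (* If [v] lies below a child of [w], the factor on the other side has no variables. If [w] lies
     strictly below [v] or apart from it, [u] does not meet both sides of [v]. *)
  case: (subtree_cases uniqT vT wT) => [vw|wv|dis].
  + case: vw => [[lE rE]|[vwl|vwr]].
    * rewrite -lE -rE in pwl swr.
      by apply: (single ((i, p), (i, s))); split.
    * apply: (lift p) => // a; rewrite uE (@gval_true (i, s)) ?andbT //.
      apply/nilP; rewrite /nilp; case S: (gvars (i, s)) => [//|y t].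
      have ys : y \in gvars (i, s) by rewrite S mem_head.
      by case: (wdis y); [apply: (sub_vleaves vwl); exact/uv/su|exact: swr].
    * apply: (lift s) => // a; rewrite uE (@gval_true (i, p)) //.
      apply/nilP; rewrite /nilp; case S: (gvars (i, p)) => [//|y t].
      have yp : y \in gvars (i, p) by rewrite S mem_head.
      by case: (wdis y); [exact: pwl|apply: (sub_vleaves vwr); exact/uv/pu].
  + case: wv => [[wlE wrE]|[wl'|wr']].
    * by apply: (single ((i, p), (i, s))); split=> //; rewrite -?wlE -?wrE.
    * by case/negP: nul; apply/allP => x /uw; apply: sub_vleaves.
    * by case/negP: nur; apply/allP => x /uw; apply: sub_vleaves.
  + by case/negP: nul; apply/allP => x xu; case: (dis x); [exact: uv|exact: uw].
(* Determinism speaks of distinct children only, so repetitions are removed; then at most one child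
   holds and the count is the value of the disjunction. *)
have [|ws [wsR wsE]] := @decomposes_seq _ gval gvars L (vleaves l) (vleaves r)
  [seq (i, c) | c <- undup cs].
  move=> _ /mapP[c + ->]; rewrite mem_undup => ccs.
  have [ck cL cu] := chL c ccs.
  by apply: IH => // x /cu /uv.
exists ws; split=> // a; rewrite wsE count_map.
have -> : gval u a = has (fun c => gval (i, c) a) (undup cs).
  rewrite /gval nvalE //= E /=; apply: eq_has_r => c; exact/esym/mem_undup.
rewrite has_count; set n := count _ _.
have : n <= 1.
  apply: count_le1 (undup_uniq _) _ => c1 c2; rewrite !mem_undup => c1s c2s c12.
  exact: (detC kC E).
by case: n => [|[]].
Qed.

End Family.

Theorem mainTheorem4 :
  exists c : nat,
  forall (X : seq nat) (f : (nat -> bool) -> bool) (D Dbar : nnf) (T : vtree),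
    uniq X ->
    vtree_on T X -> normalized T ->
    nnf_on X D -> nnf_on X Dbar ->
    structured_ddnnf D T -> smooth D -> simple D ->
    structured_ddnnf Dbar T -> smooth Dbar -> simple Dbar ->
    represents D f -> represents Dbar (fun a => ~~ f a) ->
    exists (H : seq nat) (T' : vtree) (Sd : nnf),
      uniq H /\ (forall h, h \in H -> h \notin X) /\ size H <= size X - 2 /\
      vtree_on T' (X ++ H) /\
      wf_nnf Sd /\ is_sdd (gates Sd) (outn Sd) T' /\
      represents Sd f /\
      nsize Sd <= c * (nsize D + nsize Dbar) ^ 2.
Proof.
exists 25 => X f D Dbar T uX [uT TX] _ DX DbX [[oD wfD] [_ [dD sD]]] _ _
  [[oDb wfDb] [_ [dDb sDb]]] _ _ fD fDb.
(* The third circuit supplies the gate [true], the missing factor of a gate living on one side. *)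
pose One := NNF [:: GConst true] 0.
(* As [One] is the default, the hypotheses on the family hold at every index, not only at 0, 1 and
   2. *)
pose C i := nth One [:: D; Dbar] i.
pose L := [seq (i, k) | i <- [:: 0; 1; 2], k <- iota 0 (size (gates (C i)))].
have LE u : u \in L = (u.1 < 3) && (u.2 < size (gates (C u.1))).
  apply/allpairsPdep/andP => [[i [k [+ + ->]]]|[u1 u2]].
    by rewrite mem_iota => i3 k3; split=> //; move: i3; rewrite !inE => /or3P[]/eqP->.
  exists u.1, u.2; rewrite mem_iota u2; split=> //; last by case: u {u1 u2}.
  by case: u u1 {u2} => [[|[|[|i]]] k].
have szL : size L = (nsize D + nsize Dbar).+1.
  by rewrite size_allpairs_dep /= !size_iota -!/(nsize _) addn0 addn1 addnS.
(* Past its only gate, [One] reads the default [GConst false]. *)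
have One_gate k g : gate_at (gates One) k = g -> g = GConst true \/ g = GConst false.
  by case: k => [|k] <-; [left|right; case: k].
have wfC i : wf_gates (gates (C i)).
  case: i => [|[|i]] //; rewrite /C /= => k kC c; rewrite nth_nil.
  by have [->|->] := One_gate k _ erefl.
have detC i : deterministic (C i).
  case: i => [|[|i]] //; rewrite /C /= nth_nil => k cs _ E.
  by have [] := One_gate k _ E.
have strC i : structured (C i) T.
  case: i => [|[|i]] //; rewrite /C /= nth_nil => k p s _ E.
  by have [] := One_gate k _ E.
have L_lt u : u \in L -> u.2 < size (gates (C u.1)) by rewrite LE => /andP[].
have L_closed u c : u \in L -> c < u.2 -> (u.1, c) \in L.
  by rewrite !LE /= => /andP[-> u2] cu; apply: ltn_trans u2.
have topL : (2, 0) \in L by rewrite LE.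
(* [M] exceeds every variable of [X], so the shifted labels are fresh. *)
pose M := (\max_(x <- X) x).+1.
pose H := [seq M + x | x <- aux_leaves T].
have wf0 : wf_gates [:: GConst false; GConst true] by case=> [|[|k]].
have cst0 : has_consts [:: GConst false; GConst true].
  by case=> t; [exists 1|exists 0]; split=> //; apply: sdd_const.
have [E [sE wfE HE]] := compile_vtree M uT (@gval_local C L wfC L_lt) topL
  (erefl : gvars C (2, 0) = [::]) (fun a => isT : gval C (2, 0) a)
  (gate_decomposes uT wfC detC strC L_lt L_closed topL erefl (fun=> isT))
  (is_subtree_refl T) wf0 cst0.
have oL : (0, outn D) \in L by rewrite LE.
have obL : (1, outn Dbar) \in L by rewrite LE.
have subT i : i < 2 -> {subset gvars C (i, outn (C i)) <= vleaves T}.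
  case: i => [|[|//]] _ x xi; rewrite TX.
    by have [j [p /DX]] := mem_nvars wfD oD xi.
  by have [j [p /DbX]] := mem_nvars wfDb oDb xi.
have inT : in_partition (gval C) (gvars C) L (vleaves T) (0, outn D).
  exists [:: (0, outn D); (1, outn Dbar)]; split; first exact: mem_head.
    by move=> w; rewrite !inE => /pred2P[]->; split=> //; [apply: (subT 0)|apply: (subT 1)].
  by move=> a; rewrite /= /gval /C /= fD fDb; case: (f a).
have [[k [kG kT kf]] _] := HE _ inT.
exists H, (aug_vtree M T), (NNF ([:: GConst false; GConst true] ++ E) k).
have MX h : h \in H -> h \notin X.
  case/mapP=> x _ ->; apply/negP => MxX.
  have := @leq_bigmax_seq _ X predT id _ MxX isT; rewrite /M /=; lia.
have uH : uniq H by rewrite map_inj_uniq ?aux_leaves_uniq //; apply: addnI.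
have TXp : perm_eq (vleaves T) X by apply: uniq_perm.
have TH : perm_eq (vleaves (aug_vtree M T)) (X ++ H).
  by rewrite (perm_trans (vleaves_aug M T)) // perm_cat2r.
split=> //; split=> //; split.
  by rewrite size_map -(perm_size TXp) size_aux_leaves.
split.
  split; last exact: perm_mem.
  rewrite (perm_uniq TH) cat_uniq uX uH andbT /=; exact/hasPn.
split=> //; split=> //; split; first by move=> a; rewrite kf /gval /C /= fD.
rewrite /nsize size_cat /= -!/(nsize _).
have : count (within (gvars C) (vleaves T)) L <= size L by apply: count_size.
move: sE; rewrite szL.
(* Both circuits have an output gate. With [N] at least 2, the bound
   [2 + (5 * (N + 1) + 14) * (N + 1)], where the 2 counts the initial constants, is at most
   [25 * N ^ 2]. *)
have : 1 < nsize D + nsize Dbar.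
  by rewrite /nsize; move: oD oDb; lia.
move: (nsize D + nsize Dbar) (count _ _) (size E) => N c e; rewrite expnS expn1; nia.
Qed.
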